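(* Let $\mathcal{H}_1$ and $\mathcal{H}_2$ be two real Hilbert spaces, let $B_1:\mathcal{H}_1\to 2^{\mathcal{H}_1}$ and $F_1:\mathcal{H}_2\to 2^{\mathcal{H}_2}$ be two set-valued maximal monotone mappings, and let $A:\mathcal{H}_1\to\mathcal{H}_2$ be a bounded linear operator with adjoint $A^*$. Put $L=\|A^*A\|$ and $$\Gamma:=\{x\in\mathcal{H}_1 \mid 0\in B_1(x)\ \text{and}\ 0\in F_1(A(x))\}.$$ Let $\lambda>0$. If $\Gamma\neq\emptyset$, $\gamma\in(0,2/L)$, and $\{\alpha_k\}_{k=0}^\infty\subset[0,1]$ satisfies $\lim_{k\to\infty}\alpha_k=0$ and $\sum_{k=0}^\infty\alpha_k=\infty$, then for every starting point $x^0\in\mathcal{H}_1$ the sequence $\{x^k\}_{k=0}^\infty$ generated by $$x^{k+1}=\alpha_k x^0+(1-\alpha_k)J_\lambda^{B_1}\left(I-\gamma A^*(I-J_\lambda^{F_1})A\right)(x^k),\qquad k\ge 0,$$ converges strongly (in norm) to a point $x^*\in\Gamma$.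
   Context: A set-valued mapping $B:\mathcal{H}\to 2^{\mathcal{H}}$ on a real Hilbert space $\mathcal{H}$ is monotone if $\langle u-v,x-y\rangle\ge 0$ for all $u\in B(x)$ and $v\in B(y)$; it is maximal monotone if it is monotone and its graph $G(B)=\{(x,u)\in\mathcal{H}\times\mathcal{H}\mid u\in B(x)\}$ is not properly contained in the graph of any other monotone mapping. For $\lambda>0$ the resolvent of $B$ is $J_\lambda^B:=(I+\lambda B)^{-1}$, where $I$ is the identity operator; it is well known that for maximal monotone $B$ it is single-valued and defined on all of $\mathcal{H}$. *)

(* Defs.v *)
From HB Require Import structures.
From mathcomp Require Import all_boot all_order all_algebra.
From mathcomp Require Import all_classical all_reals all_analysis.

Set Implicit Arguments.
Unset Strict Implicit.
Unset Printing Implicit Defensive.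

Import Order.TTheory GRing.Theory Num.Theory.
Import numFieldNormedType.Exports.

Local Open Scope classical_set_scope.
Local Open Scope ring_scope.

HB.mixin Record hasInner (R : realType) H & CompleteNormedModule R H := {
  inner : {dot H for (@idfun R)} ;
  norm_inner : forall x : H, `|x| ^+ 2 = inner x x
}.

#[short(type="hilbertType")]
HB.structure Definition Hilbert (R : realType) :=
  {H of hasInner R H & CompleteNormedModule R H}.

Notation "'[< x , y >]" := (inner x y)
  (at level 0, x at level 99, y at level 99) : ring_scope.

Section SetValuedMappings.
Variables (R : realType) (H : hilbertType R).
Implicit Types B C : H -> set H.

Definition graph B : set (H * H) := [set p | B p.1 p.2].

Definition monotone B := forall x y u v : H,
  B x u -> B y v -> 0 <= '[< u - v, x - y >].

Definition maximal_monotone B :=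
  monotone B /\ forall C, monotone C -> ~ (graph B `<` graph C).

Definition inv_map B : H -> set H := fun x => [set y | B y x].

Definition id_add_scale (lambda : R) B : H -> set H :=
  fun x => [set x + lambda *: u | u in B x].

(* The set-valued mapping (I + lambda B)^-1 read as a function, with value 0
   at the points where it is empty; for maximal monotone B and lambda > 0
   every value is a singleton, so neither the default nor the choice matters. *)
Definition resolvent (lambda : R) B : H -> H :=
  fun_of_rel (fun=> 0) (inv_map (id_add_scale lambda B)).

End SetValuedMappings.

Section Operators.
Variables (R : realType).

(* As for the resolvent, 0 is only a default: it is not reached for bounded
   linear A, whose adjoint exists and is unique by the Riesz theorem. *)
Definition adjoint (H1 H2 : hilbertType R) (A : H1 -> H2) : H2 -> H1 :=
  fun_of_rel (fun=> 0)
    (fun y => [set z | forall x, '[< A x, y >] = '[< x, z >]]).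

Definition opnorm (V W : normedModType R) (T : V -> W) : R :=
  sup [set `|T x| | x in [set x : V | `|x| <= 1]].

End Operators.

Section SplitInclusion.
Variables (R : realType) (H1 H2 : hilbertType R).
Variables (B1 : H1 -> set H1) (F1 : H2 -> set H2) (A : H1 -> H2).

Definition solution_set : set H1 := [set x | B1 x 0 /\ F1 (A x) 0].

Definition forward_step (lambda gamma : R) (x : H1) : H1 :=
  x - gamma *: adjoint A (A x - resolvent lambda F1 (A x)).

End SplitInclusion.

(* Main.v *)
(* The iteration is Halpern's for T = J_lambda^B1 o U, where
   U = I - gamma A^*(I - J_lambda^F1)A.  Firm nonexpansiveness of the
   resolvents and gamma L < 2 make T nonexpansive with
   |T x - w|^2 <= |x - w|^2 - c |x - T x|^2 for w in Gamma = Fix T.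
   That the resolvents are everywhere defined (Minty) and that the adjoint
   exists (Riesz) both come from minimizing c + (|x|^2 + |u|^2) / 2 over a
   closed convex set of triples (x, u, c), by completeness alone.
   The limit z is that of Browder's curve z_h = T z_h + h (x0 - z_h), h -> 0;
   monotonicity of I - T along this curve bounds <x0 - z, x - z> by any e > 0
   at every point x of a bounded set whose displacement |x - T x| is small
   enough. *)
Require Import Defs.
From HB Require Import structures.
From mathcomp Require Import all_boot all_order all_algebra.
From mathcomp Require Import all_classical all_reals all_analysis.
From mathcomp Require Import ring lra.

Set Implicit Arguments.
Unset Strict Implicit.
Unset Printing Implicit Defensive.

Import Order.TTheory GRing.Theory Num.Theory.
Import numFieldNormedType.Exports.

Local Open Scope classical_set_scope.
Local Open Scope ring_scope.

(** * Inner products *)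

Section InnerProduct.
Variables (R : realType) (H : hilbertType R).
Implicit Types (x y z : H) (a : R).

Lemma innerC x y : '[< x, y >] = '[< y, x >].
Proof. by rewrite hermC /= expr0 mul1r. Qed.

Lemma innerDl x y z : '[< x + y, z >] = '[< x, z >] + '[< y, z >].
Proof. exact: linearDl. Qed.

Lemma innerNl x z : '[< - x, z >] = - '[< x, z >].
Proof. exact: linearNl. Qed.

Lemma innerZl a x z : '[< a *: x, z >] = a * '[< x, z >].
Proof. exact: linearZl_LR. Qed.

Lemma innerDr z x y : '[< z, x + y >] = '[< z, x >] + '[< z, y >].
Proof. by rewrite innerC innerDl !(innerC z). Qed.

Lemma innerNr z x : '[< z, - x >] = - '[< z, x >].
Proof. by rewrite innerC innerNl innerC. Qed.

Lemma innerZr a z x : '[< z, a *: x >] = a * '[< z, x >].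
Proof. by rewrite innerC innerZl innerC. Qed.

Lemma inner0l x : '[< 0, x >] = 0.
Proof. by rewrite -(scale0r x) innerZl mul0r. Qed.

Lemma inner0r x : '[< x, 0 >] = 0.
Proof. by rewrite innerC inner0l. Qed.

Definition innerE :=
  (innerDl, innerDr, innerNl, innerNr, innerZl, innerZr, inner0l, inner0r).

Lemma inner_ge0 x : 0 <= '[< x, x >].
Proof. by rewrite -norm_inner sqr_ge0. Qed.

Lemma inner_eq0 x : '[< x, x >] = 0 -> x = 0.
Proof.
by rewrite -norm_inner => /eqP; rewrite sqrf_eq0 normr_eq0 => /eqP.
Qed.

(** Expand the square of |y| x - |x| y and divide by |x| |y|. The left side is signed; the opposite
    bound comes from applying this to [- x]. *)
Lemma cauchy_schwarz x y : '[< x, y >] <= `|x| * `|y|.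
Proof.
have [->|x0] := eqVneq x 0; first by rewrite inner0l normr0 mul0r.
have [->|y0] := eqVneq y 0; first by rewrite inner0r normr0 mulr0.
have := inner_ge0 (`|y| *: x - `|x| *: y).
rewrite !innerE -!norm_inner (innerC y x).
have : 0 < `|x| * `|y| by rewrite mulr_gt0 ?normr_gt0.
move: `|x| `|y| '[< x, y >] => a b c ab.
rewrite -(ler_pM2l ab); nra.
Qed.

Lemma cvg_inner_l (u : nat -> H) x y :
  u n @[n --> \oo] --> x -> '[< u n, y >] @[n --> \oo] --> '[< x, y >].
Proof.
move=> ux; apply/subr_cvg0; apply/cvgr0Pnorm_lt => e e0.
have b0 : 0 < `|y| + 1 by rewrite ltr_wpDl.
move/cvgrPdist_lt : ux => /(_ (e / (`|y| + 1)) (divr_gt0 e0 b0)).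
apply: filterS => n; rewrite ltr_pdivlMr// => ux.
rewrite -innerNl -innerDl.
have h : `|u n - x| * `|y| < e.
  by rewrite distrC (le_lt_trans _ ux)// ler_wpM2l// lerDl.
rewrite ltr_norml; apply/andP; split; last first.
  exact: le_lt_trans (cauchy_schwarz _ _) h.
rewrite ltrNl -innerNl; apply: le_lt_trans (cauchy_schwarz _ _) _.
by rewrite normrN.
Qed.

Lemma cvg_inner_r (u : nat -> H) x y :
  u n @[n --> \oo] --> x -> '[< y, u n >] @[n --> \oo] --> '[< y, x >].
Proof.
by move=> /(@cvg_inner_l _ _ y); under eq_fun do rewrite innerC; rewrite innerC.
Qed.

Lemma cvg_sq_norm (u : nat -> H) x :
  u n @[n --> \oo] --> x -> `|u n| ^+ 2 @[n --> \oo] --> `|x| ^+ 2.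
Proof. move=> /cvg_norm ux; exact: (cvgM ux ux). Qed.

Lemma cvgn_sq_dist (u : nat -> H) (e : nat -> R) :
  e n @[n --> \oo] --> 0 ->
  (forall n m, (n <= m)%N -> `|u n - u m| ^+ 2 <= e n) -> cvgn u.
Proof.
move=> e0 ue; apply/cauchy_cvgP/cauchy_exP => d d0.
have d20 : 0 < d ^+ 2 by rewrite exprn_gt0.
move/cvgr0Pnorm_lt : e0 => /(_ _ d20)[N _ eN].
exists (u N), N => // n /= Nn; rewrite -ball_normE /=.
rewrite -(@ltr_pXn2r _ 2) ?nnegrE ?(ltW d0)//.
apply: le_lt_trans (ue _ _ Nn) (le_lt_trans (ler_norm _) (eN _ (leqnn N))).
Qed.

End InnerProduct.

(** * Minimization of strongly convex functions *)

Section Variational.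
Variables (R : realType) (H : hilbertType R).

(** The quadratic term makes minimizing sequences Cauchy, so closedness of [E] yields a minimizer
    without weak compactness. The conclusion is its first-order optimality condition. It serves both
    the Fitzpatrick function and Riesz representation. *)
Lemma strongly_convex_min (E : H -> H -> R -> Prop) (b : R) :
  (exists x u c, E x u c) ->
  (forall x u c y v d (t : R), E x u c -> E y v d -> 0 <= t <= 1 ->
    E (x + t *: (y - x)) (u + t *: (v - u)) (c + t * (d - c))) ->
  (forall (X U : nat -> H) (C : nat -> R) x u c,
    (forall n, E (X n) (U n) (C n)) ->
    X n @[n --> \oo] --> x -> U n @[n --> \oo] --> u ->
    C n @[n --> \oo] --> c -> E x u c) ->
  (forall x u c, E x u c -> b <= c + (`|x| ^+ 2 + `|u| ^+ 2) / 2) ->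
  exists x u c, E x u c /\
    forall y v d, E y v d -> 0 <= d - c + '[< x, y - x >] + '[< u, v - u >].
Proof.
move=> [xE [uE [cE EE]]] Econv Eclosed Ebound.
pose phi (p : H * H * R) := p.2 + (`|p.1.1| ^+ 2 + `|p.1.2| ^+ 2) / 2.
pose ES := [set p : H * H * R | E p.1.1 p.1.2 p.2].
pose m := inf (phi @` ES).
have infS : has_inf (phi @` ES).
  split; first by exists (phi (xE, uE, cE)), (xE, uE, cE).
  by exists b => _ [[[x u] c] /= Ep <-]; exact: Ebound.
have mle p : ES p -> m <= phi p.
  by move=> Ep; apply: ge_inf; [exact: infS.2|exists p].
have approx n : exists p, ES p /\ phi p < m + @harmonic R n.
  have [|_ [p Ep <-] pm] := @inf_adherent _ (phi @` ES) (@harmonic R n) _ infS.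
    exact: harmonic_gt0.
  by exists p.
have [s sP] := choice approx.
pose X n := (s n).1.1; pose U n := (s n).1.2; pose C n := (s n).2.
(* Parallelogram law: at the midpoint, [phi] is the average of its two values minus 1/8 of the left
   side, and it is still at least [m]. *)
have XUclose i j : (i <= j)%N ->
    `|X i - X j| ^+ 2 + `|U i - U j| ^+ 2 <= 8 * @harmonic R i.
  move=> ij; have [Ei li] := sP i; have [Ej lj] := sP j.
  have hji : @harmonic R j <= @harmonic R i.
    by rewrite /harmonic/= lef_pV2 ?posrE ?ltr0n// ler_nat.
  have half01 : 0 <= (2^-1 : R) <= 1 by lra.
  have /(mle (_, _, _)) := Econv _ _ _ _ _ _ _ Ei Ej half01.
  move: li lj; rewrite /phi /X /U /=.
  move: (s i) (s j) => [[x u] c] [[y v] d] /=.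
  rewrite !norm_inner !innerE (innerC y x) (innerC v u).
by move: hji; rewrite /harmonic/=; move: (i.+1%:R^-1) (j.+1%:R^-1) => a a' *; lra.
have h0 : 8 * @harmonic R n @[n --> \oo] --> (0 : R).
  by rewrite -[X in _ --> X](mulr0 8); apply: cvgM; [exact: cvg_cst|exact: cvg_harmonic].
have Xc : cvgn X.
  apply: (cvgn_sq_dist h0) => i j /XUclose; apply: le_trans.
  by rewrite lerDl sqr_ge0.
have Uc : cvgn U.
  apply: (cvgn_sq_dist h0) => i j /XUclose; apply: le_trans.
  by rewrite lerDr sqr_ge0.
pose x := limn X; pose u := limn U.
pose c := m - (`|x| ^+ 2 + `|u| ^+ 2) / 2.
have phic : phi (s n) @[n --> \oo] --> m.
  apply: (@squeeze_cvgr _ _ _ _ (cst m) (fun n => m + @harmonic R n)).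
  - by apply: nearW => n; have [/mle -> /ltW ->] := sP n.
  - exact: cvg_cst.
  - rewrite -[X in _ --> X]addr0; apply: cvgD; [exact: cvg_cst|exact: cvg_harmonic].
have Cc : C n @[n --> \oo] --> c.
  have -> : C = (fun n => phi (s n) - (`|X n| ^+ 2 + `|U n| ^+ 2) / 2).
    by apply/funext => n; rewrite /phi/= addrK.
  apply: cvgB => //; apply: cvgM; last exact: cvg_cst.
  by apply: cvgD; exact: cvg_sq_norm.
have Ep : E x u c by apply: (Eclosed X U C) => // n; have [] := sP n.
exists x, u, c; split=> // y v d Eq.
set w := d - c + _ + _; set k := (`|y - x| ^+ 2 + `|v - u| ^+ 2) / 2.
have k0 : 0 <= k by rewrite divr_ge0// addr_ge0// sqr_ge0.
(* On the segment from the minimizer towards [(y, v, d)], [phi] equals m + t (w + t k). *)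
have wk t : 0 < t -> t <= 1 -> 0 <= w + t * k.
  move=> t0 t1; have t01 : 0 <= t <= 1 by rewrite ltW.
  have /(mle (_, _, _)) := Econv _ _ _ _ _ _ _ Ep Eq t01.
  rewrite /phi/= -(pmulr_rge0 _ t0) -subr_ge0; congr (0 <= _).
  rewrite /w /k /c !norm_inner !innerE (innerC y x) (innerC v u).
  by field.
(* If w < 0, then t = - w / (k - w) gives w + t k = - w^2 / (k - w) < 0, against [wk]. *)
rewrite leNgt; apply/negP => w0.
have kw : 0 < k - w by lra.
have q0 : 0 < - w / (k - w) by rewrite divr_gt0 ?oppr_gt0.
have q1 : - w / (k - w) <= 1 by rewrite ler_pdivrMr//; lra.
have /(mulr_ge0 (ltW kw)) := wk _ q0 q1.
have -> : (k - w) * (w + - w / (k - w) * k) = - (w ^+ 2).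
  by field; rewrite gt_eqF.
by rewrite oppr_ge0 leNgt exprn_even_gt0//= lt_eqF.
Qed.

End Variational.

(** * Maximal monotone mappings and resolvents *)

Section MaximalMonotone.
Variables (R : realType) (H : hilbertType R).
Implicit Types (B : H -> set H) (x y u v : H).

(** Otherwise adjoining [(x, u)] to the graph would give a proper monotone extension. *)
Lemma maximal_monotone_related B x u : maximal_monotone B ->
  (forall y v, B y v -> 0 <= '[< u - v, x - y >]) -> B x u.
Proof.
move=> [Bmono Bmax] xu; apply: contrapT => nBxu.
pose C : H -> set H := fun y => B y `|` [set v | y = x /\ v = u].
apply: (Bmax C); last first.
  split=> [[y v] /=|BC]; first by left.
  by apply: nBxu; apply: (BC (x, u)); right.
move=> y z v w [Byv|[-> ->]] [Bzw|[-> ->]].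
- exact: Bmono.
- have -> : v - u = - (u - v) by rewrite opprB.
  have -> : y - x = - (x - y) by rewrite opprB.
  by rewrite innerNl innerNr opprK; exact: xu.
- exact: xu.
- by rewrite !subrr inner0l.
Qed.

(* [E] is the epigraph of the Fitzpatrick function of [B]; the minimizer
   [(x, u)] of that function plus [(|x|^2 + |u|^2) / 2] turns out to satisfy
   [u = - x] and [B x u]. *)
Lemma monotone_related_zero B : Defs.monotone B ->
  (forall x u, (forall y v, B y v -> 0 <= '[< u - v, x - y >]) -> B x u) ->
  exists x, B x (- x).
Proof.
move=> Bmono Brel.
pose E x u (c : R) :=
  forall y v, B y v -> '[< x, v >] + '[< y, u >] - '[< y, v >] <= c.
(* The Fitzpatrick function dominates the pairing: if c < <x, u>, then [(x, u)] is monotonically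
   related to [B], hence in it, and testing [E] at [(x, u)] itself gives <x, u> <= c. *)
have Ege x u c : E x u c -> '[< x, u >] <= c.
  move=> Exu; rewrite leNgt; apply/negP => cxu.
  have Bxu : B x u.
    apply: Brel => y v /Exu h.
    rewrite !innerE (innerC u x) (innerC u y) (innerC v x) (innerC v y).
    by move: h; lra.
  by have := Exu _ _ Bxu; lra.
have EB y v : B y v -> E y v '[< y, v >].
  move=> Byv z w Bzw; have := Bmono _ _ _ _ Byv Bzw.
  rewrite !innerE (innerC v y) (innerC v z) (innerC w y) (innerC w z); lra.
have [y0 [v0 Byv0]] : exists y v, B y v.
  apply: contrapT => nB; apply: (nB); exists 0, 0; apply: Brel => y v Byv.
  by exfalso; apply: nB; exists y, v.
have [||||x [u [c [Exu opt]]]] := @strongly_convex_min R H E 0.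
- by exists y0, v0, '[< y0, v0 >]; exact: EB.
- move=> x u c y v d t Exu Eyv /andP[t0 t1] z w Bzw.
  have t1' : 0 <= 1 - t by rewrite subr_ge0.
  have := ler_wpM2l t1' (Exu _ _ Bzw); have := ler_wpM2l t0 (Eyv _ _ Bzw).
  by rewrite !innerE; lra.
- move=> X U C x u c EX Xx Uu Cc z w Bzw.
  apply: (@ler_cvg_to nat \oo _ R
    (fun n => '[< X n, w >] + '[< z, U n >] - '[< z, w >]) C) => //.
    apply: cvgB; last exact: cvg_cst.
    by apply: cvgD; [exact: cvg_inner_l|exact: cvg_inner_r].
  by apply: nearW => n; exact: EX.
- move=> x u c /Ege xuc; have := inner_ge0 (x + u).
  by rewrite !norm_inner !innerE (innerC u x); lra.
have xuc := Ege _ _ _ Exu.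
(* Optimality tested at [(y, v, <y, v>)], combined with <x, u> <= c. It puts [(- u, - x)] in [B];
   taken at that very pair, it then forces x + u = 0. *)
have rel y v : B y v -> '[< x + u, x + u >] <= '[< - x - v, - u - y >].
  move=> /EB /opt; rewrite !innerE (innerC u x) (innerC v u) (innerC v y).
  by lra.
have Bux : B (- u) (- x).
  by apply: Brel => y v /rel; apply: le_trans; exact: inner_ge0.
have xu0 : x + u = 0.
  apply: inner_eq0; apply: le_anti; rewrite inner_ge0 andbT.
  by apply: le_trans (rel _ _ Bux) _; rewrite subrr inner0l.
by exists x; rewrite -(addr0_eq xu0) opprK in Bux.
Qed.

(** Apply the preceding lemma to [B'], which is lambda B - y: - x in B' x means that y - x lies in
    lambda B x. *)
Lemma minty B (lambda : R) y : maximal_monotone B -> 0 < lambda ->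
  exists x u, B x u /\ x + lambda *: u = y.
Proof.
move=> Bmax l0; have ln0 : lambda != 0 by rewrite gt_eqF.
pose B' : H -> set H := fun x => [set w | B x (lambda^-1 *: (w + y))].
have scaleB u v x z : '[< lambda^-1 *: (u + y) - lambda^-1 *: (v + y), x - z >]
    = lambda^-1 * '[< u - v, x - z >].
  by rewrite -scalerBr innerZl opprD addrACA subrr addr0.
have [||x Bx] := @monotone_related_zero B'.
- move=> x z u v Bxu Bzv; have := Bmax.1 _ _ _ _ Bxu Bzv.
  by rewrite scaleB pmulr_rge0// invr_gt0.
- move=> x u xu; apply: (maximal_monotone_related Bmax) => z v Bzv.
  have vE : v = lambda^-1 *: ((lambda *: v - y) + y).
    by rewrite subrK scalerA mulVf// scale1r.
  rewrite vE scaleB pmulr_rge0 ?invr_gt0//; apply: xu.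
  by rewrite /B'/= -vE.
exists x, (lambda^-1 *: (- x + y)); split=> //.
by rewrite scalerA divff// scale1r addrA subrr add0r.
Qed.

Lemma resolventP B (lambda : R) y : maximal_monotone B -> 0 < lambda ->
  exists2 u, B (resolvent lambda B y) u &
             resolvent lambda B y + lambda *: u = y.
Proof.
move=> Bmax l0; rewrite /resolvent.
suff : inv_map (id_add_scale lambda B) y
    (fun_of_rel (fun=> 0) (inv_map (id_add_scale lambda B)) y).
  by case=> u; exists u.
apply: fun_of_relP; have [x [u [Bxu xuy]]] := minty y Bmax l0.
by exists x, u.
Qed.

Section Resolvent.
Variables (B : H -> set H) (lambda : R).
Hypotheses (Bmax : maximal_monotone B) (l0 : 0 < lambda).
Local Notation J := (resolvent lambda B).

(** This is monotonicity of [B] at [J x] and [J y], with the elements (x - J x) / lambda and (y - J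
    y) / lambda. *)
Lemma resolvent_firmly_nonexpansive x y :
  `|J x - J y| ^+ 2 <= '[< J x - J y, x - y >].
Proof.
have [u Bu xE] := resolventP x Bmax l0; have [v Bv yE] := resolventP y Bmax l0.
have := Bmax.1 _ _ _ _ Bu Bv; rewrite -(pmulr_rge0 _ l0) -innerZl scalerBr.
have -> : lambda *: u = x - J x by rewrite -(addKr (J x) (lambda *: u)) xE addrC.
have -> : lambda *: v = y - J y by rewrite -(addKr (J y) (lambda *: v)) yE addrC.
rewrite norm_inner !innerE (innerC x) (innerC y (J x)) (innerC y (J y)) (innerC (J y) (J x)).
by rewrite (innerC x (J y)); lra.
Qed.

Lemma resolvent_fixedP x : J x = x <-> B x 0.
Proof.
have [u Bu xE] := resolventP x Bmax l0; split=> [Jx|Bx0].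
  suff u0 : u = 0 by rewrite -{1}Jx -u0.
  move: xE; rewrite Jx => /(canRL (addKr _)); rewrite addNr => /eqP.
  by rewrite scaler_eq0 gt_eqF//= => /eqP.
(* The pairs [(J x, u)] and [(x, 0)] give 0 <= <u, J x - x> = - lambda |u|^2, so u = 0. *)
have := Bmax.1 _ _ _ _ Bu Bx0; rewrite subr0.
have -> : J x - x = - (lambda *: u) by rewrite -(addKr (J x) (lambda *: u)) xE opprD opprK.
rewrite innerNr innerZr oppr_ge0 pmulr_rle0// => u0.
have {}u0 : u = 0 by apply: inner_eq0; apply: le_anti; rewrite u0 inner_ge0.
by move: xE; rewrite u0 scaler0 addr0.
Qed.

End Resolvent.

End MaximalMonotone.

(** * Riesz representation and adjoints *)

Section Adjoint.
Variables (R : realType).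

Lemma bounded_linear_bound (V W : normedModType R) (A : {linear V -> W}) :
  bounded_fun_norm A -> exists2 K, 0 < K & forall x, `|A x| <= K * `|x|.
Proof.
move=> /bounded_funP/linear_boundedP/pinfty_ex_gt0[K K0 KA].
by exists K.
Qed.

(** The representer minimizes |x|^2 / 2 - f x, which is at least - K^2 / 2. Optimality in the
    directions [y] and [- y] gives the equality. *)
Lemma riesz (H : hilbertType R) (f : H -> R) (K : R) :
  (forall a x y, f (a *: x + y) = a * f x + f y) ->
  (forall x, `|f x| <= K * `|x|) ->
  exists z, forall x, f x = '[< x, z >].
Proof.
move=> flin fK.
have fD x y : f (x + y) = f x + f y by rewrite -{1}(scale1r x) flin mul1r.
have f0 : f 0 = 0 by apply: (@addrI _ (f 0)); rewrite -fD !addr0.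
have fZ a x : f (a *: x) = a * f x by rewrite -[a *: x]addr0 flin f0 addr0.
have fN x : f (- x) = - f x by rewrite -scaleN1r fZ mulN1r.
have [||||x [u [c [[u0 cE] opt]]]] :=
  @strongly_convex_min R H (fun x u c => u = 0 /\ c = - f x) (- (K ^+ 2 / 2)).
- by exists 0, 0, (- f 0).
- move=> x u c y v d t [-> ->] [-> ->] _; split; first by rewrite subrr scaler0 addr0.
  by rewrite fD fZ fD fN; ring.
- move=> X U C x u c XUC Xx Uu Cc; split.
    have U0 : U = cst 0 by apply/funext => n; have [] := XUC n.
    apply: (cvg_unique _ Uu); first exact: norm_hausdorff.
    by rewrite U0; exact: cvg_cst.
  have CE : C = (fun n => - f (X n)) by apply/funext => n; have [] := XUC n.
  apply: (cvg_unique _ Cc); first exact: norm_hausdorff.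
  rewrite CE; apply: cvgN; apply/subr_cvg0; apply/cvgr0Pnorm_lt => e e0.
  have K0 : 0 < `|K| + 1 by rewrite ltr_wpDl.
  move/cvgrPdist_lt : Xx => /(_ (e / (`|K| + 1)) (divr_gt0 e0 K0)).
  apply: filterS => n; rewrite ltr_pdivlMr// => Xx; rewrite -fN -fD.
  apply: le_lt_trans (fK _) (le_lt_trans _ Xx).
  rewrite distrC mulrC ler_wpM2l//.
  by rewrite (le_trans (ler_norm K))// lerDl.
- move=> x u c [-> ->]; rewrite normr0 expr0n addr0.
  have := le_trans (ler_norm _) (fK x); have := sqr_ge0 (K - `|x|).
  by rewrite sqrrB; lra.
exists x => y; apply/eqP; rewrite -subr_eq0; apply/eqP; apply: le_anti.
have := opt (x + y) 0 (- f (x + y)) (conj erefl erefl).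
have := opt (x - y) 0 (- f (x - y)) (conj erefl erefl).
rewrite u0 cE !fD fN !innerE (innerC y x) => h1 h2.
by apply/andP; split; lra.
Qed.

Variables (H1 H2 : hilbertType R) (A : {linear H1 -> H2}).
Hypothesis Abnd : bounded_fun_norm A.
Local Notation L := (opnorm (adjoint A \o A)).

Lemma adjointP x y : '[< A x, y >] = '[< x, adjoint A y >].
Proof.
have [K K0 KA] := bounded_linear_bound Abnd.
rewrite /adjoint; set S := fun y => [set z | _].
suff : S y (fun_of_rel (fun=> 0) S y) by apply.
apply: fun_of_relP.
have [||z zP] := @riesz H1 (fun x => '[< A x, y >]) (K * `|y|).
- by move=> a u v; rewrite linearD linearZ/= !innerE.
- move=> u; have hu : `|A u| * `|y| <= K * `|y| * `|u|.
    by rewrite mulrAC ler_wpM2r.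
  rewrite ler_norml (le_trans (cauchy_schwarz _ _) hu) andbT lerNl -innerNl.
  by rewrite (le_trans (cauchy_schwarz _ _))// normrN.
- by exists z.
Qed.

(** [adjoint] is a chosen function, so its linearity is recovered from [adjointP] by pairing the
    defect with itself. *)
Lemma adjointB x y : adjoint A (x - y) = adjoint A x - adjoint A y.
Proof.
apply: subr0_eq; apply: inner_eq0; set z := (X in '[< X, X >]).
by rewrite {2}/z !innerE -!adjointP !innerE; ring.
Qed.

Lemma adjointZ a x : adjoint A (a *: x) = a *: adjoint A x.
Proof.
apply: subr0_eq; apply: inner_eq0; set z := (X in '[< X, X >]).
by rewrite {2}/z !innerE -!adjointP !innerE; ring.
Qed.

(** A [sup] dominates its set only once an upper bound is exhibited. Here K^2 is one, since the
    adjoint inherits the bound [K] of [A]. *)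
Lemma norm_adjoint_le_opnorm x : `|x| <= 1 -> `|adjoint A (A x)| <= L.
Proof.
have [K K0 KA] := bounded_linear_bound Abnd.
have AK y : `|adjoint A y| <= K * `|y|.
  have [->|a0] := eqVneq (adjoint A y) 0; first by rewrite normr0 mulr_ge0// ltW.
  rewrite -(@ler_pM2l _ `|adjoint A y|) ?normr_gt0// -expr2 norm_inner -adjointP.
  apply: le_trans (cauchy_schwarz _ _) _.
  by rewrite mulrA [_ * K]mulrC ler_wpM2r.
move=> x1; apply: ub_le_sup; last by exists x.
exists (K * K) => _ [y /= y1 <-].
apply: le_trans (AK _) _; rewrite ler_pM2l//.
by apply: le_trans (KA _) _; rewrite ler_piMr// ltW.
Qed.

Lemma opnorm_adjoint_ge0 : 0 <= L.
Proof.
by apply: le_trans (normr_ge0 _) (@norm_adjoint_le_opnorm 0 _); rewrite normr0.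
Qed.

Lemma sq_norm_le_opnorm x : `|A x| ^+ 2 <= L * `|x| ^+ 2.
Proof.
have [->|x0] := eqVneq x 0; first by rewrite linear0 !normr0 expr0n mulr0.
have nx0 : 0 < `|x| by rewrite normr_gt0.
have Lx : `|adjoint A (A x)| <= L * `|x|.
  rewrite -ler_pdivrMr//.
  have -> : `|adjoint A (A x)| / `|x| = `|adjoint A (A (`|x|^-1 *: x))|.
    by rewrite linearZ/= adjointZ normrZ mulrC ger0_norm// invr_ge0.
  apply: norm_adjoint_le_opnorm.
  by rewrite normrZ normfV normr_id mulVf// gt_eqF.
rewrite norm_inner adjointP (le_trans (cauchy_schwarz _ _))//.
by rewrite expr2 mulrCA ler_wpM2l.
Qed.

(** With a = [adjoint A y], |a|^2 = <A a, y> gives |a|^4 <= |A a|^2 |y|^2 <= L |a|^2 |y|^2. *)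
Lemma sq_norm_adjoint_le_opnorm y : `|adjoint A y| ^+ 2 <= L * `|y| ^+ 2.
Proof.
set a := adjoint A y.
have [->|a0] := eqVneq a 0.
  by rewrite normr0 expr0n mulr_ge0// opnorm_adjoint_ge0.
have a2 : 0 < `|a| ^+ 2 by rewrite exprn_gt0// normr_gt0.
rewrite -(ler_pM2l a2).
apply: le_trans (_ : `|A a| ^+ 2 * `|y| ^+ 2 <= _); last first.
  by rewrite [leRHS]mulrCA [leRHS]mulrA ler_wpM2r ?sqr_ge0// sq_norm_le_opnorm.
have h : `|a| ^+ 2 <= `|A a| * `|y|.
  by rewrite norm_inner -adjointP cauchy_schwarz.
by rewrite -[leLHS]expr2 -[leRHS]exprMn lerXn2r ?nnegrE ?mulr_ge0 ?sqr_ge0.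
Qed.

End Adjoint.

(** * Halpern iteration *)

Section Halpern.
Variables (R : realType).

(** While s k > 2 e, each step lowers [s] by at least [alpha k * e], which divergence of the sum
    cannot allow forever. Once below 2 e, [s] stays there by convexity. *)
Lemma eventually_le_of_divergent_weights (alpha s : nat -> R) (e : R) (K : nat) :
  (forall k, 0 <= alpha k <= 1) -> (forall k, 0 <= s k) ->
  (\sum_(0 <= k <oo) (alpha k)%:E = +oo)%E -> 0 < e ->
  (forall k, (K <= k)%N -> s k.+1 <= (1 - alpha k) * s k + alpha k * e) ->
  \forall k \near \oo, s k <= 2 * e.
Proof.
move=> a01 s0 aoo e0 sS.
have [N KN sN] : exists2 N, (K <= N)%N & s N <= 2 * e.
  apply: contrapT => big.
  have sbig k : (K <= k)%N -> 2 * e < s k.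
    by move=> Kk; rewrite ltNge; apply/negP => sk; apply: big; exists k.
  have dec n : e * \sum_(0 <= i < n) alpha (K + i)%N <= s K - s (K + n)%N.
    elim: n => [|n IH]; first by rewrite big_geq// addn0 subrr mulr0.
    have /andP[a0 a1] := a01 (K + n)%N.
    have := sS _ (leq_addr n K); have := sbig _ (leq_addr n K).
    rewrite big_nat_recr//= mulrDr addnS => /ltW/(ler_wpM2l a0).
    by move: IH; lra.
  have : (\sum_(0 <= k <oo) (alpha k)%:E <=
      (\sum_(0 <= k < K) alpha k + s K / e)%:E)%E.
    apply: lime_le; first by apply: is_cvg_nneseries => n _ _; rewrite lee_fin; have /andP[] := a01 n.
    exists K => // n /= Kn; rewrite sumEFin lee_fin (big_cat_nat _ Kn)//= lerD2l.
    rewrite ler_pdivlMr// mulrC -{1}(add0n K) big_addn.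
    under eq_bigr do rewrite addnC.
    by apply: le_trans (dec _) _; rewrite lerBlDr lerDl.
  by rewrite aoo leye_eq.
exists N => // k /=; elim: k => [|k IH].
  by rewrite leqn0 => /eqP N0; move: sN; rewrite N0.
rewrite leq_eqVlt => /orP[/eqP <-//|]; rewrite ltnS => Nk.
have /andP[a0 a1] := a01 k; have a1' : 0 <= 1 - alpha k by rewrite subr_ge0.
have := sS _ (leq_trans KN Nk); have := ler_wpM2l a1' (IH Nk).
by have := mulr_ge0 a0 (ltW e0); lra.
Qed.

Variables (H : hilbertType R) (T : H -> H).
Hypothesis Tnexp : forall x y, `|T x - T y| <= `|x - y|.

Lemma displacement_monotone x y :
  0 <= '[< (x - T x) - (y - T y), x - y >].
Proof.
have -> : (x - T x) - (y - T y) = (x - y) - (T x - T y).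
  by rewrite !opprD !opprK addrACA.
have := Tnexp x y; rewrite -(@ler_pXn2r _ 2) ?nnegrE//.
move: (x - y) (T x - T y) => a b; have := inner_ge0 (a - b).
by rewrite !norm_inner !innerE (innerC b a); lra.
Qed.

(** Banach's theorem for z |-> (h x0 + T z) / (1 + h), a contraction of ratio 1 / (1 + h). *)
Lemma approximate_fixed_point x0 (h : R) : 0 < h ->
  exists z, z - T z = h *: (x0 - z).
Proof.
move=> h0; have h10 : 0 < 1 + h by lra.
pose q := (1 + h)^-1; have q0 : 0 < q by rewrite invr_gt0.
pose f0 (z : H) := q *: (h *: x0 + T z).
have f0S : set_fun setT setT f0 by [].
pose mf := isFun.Build H H setT setT f0 f0S.
pose f : {fun [set: H] >-> [set: H]} := HB.pack f0 mf.
have fc : is_contraction f.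
  exists (NngNum (ltW q0)); split=> /=; first by rewrite invf_lt1//; lra.
  move=> [x y] _ /=; rewrite /f0 -scalerBr opprD addrACA subrr add0r.
  by rewrite normrZ gtr0_norm// ler_wpM2l// ltW.
have [z _ zE] := banach_fixed_point fc closedT (ex_intro _ 0 I).
exists z; have {zE} : (1 + h) *: z = h *: x0 + T z.
  by rewrite [in LHS]zE /= /f0 scalerA divff ?gt_eqF// scale1r.
rewrite scalerDl scale1r scalerBr => zE.
by apply/eqP; rewrite subr_eq addrAC eq_sym subr_eq zE eq_sym.
Qed.

(* The curve [h |-> z_h] with [z_h - T z_h = h (x0 - z_h)] converges to the
   desired point as [h -> 0]; monotonicity of [id - T] replaces weak
   compactness and demiclosedness. *)
Lemma browder_limit x0 p : T p = p ->
  exists2 z, T z = z & forall M e, 0 <= M -> 0 < e -> exists2 eta, 0 < eta &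
    forall x, `|x - z| <= M -> `|x - T x| <= eta -> '[< x0 - z, x - z >] <= e.
Proof.
move=> Tp.
have [Z ZE] := choice (fun n => approximate_fixed_point x0 (@harmonic_gt0 R n)).
pose h n : R := @harmonic R n; have h_gt0 n : 0 < h n := harmonic_gt0 n.
pose Q := `|p - x0|.
have ZQ2 n : `|Z n - x0| ^+ 2 <= Q ^+ 2.
  have := displacement_monotone (Z n) p; rewrite ZE Tp subrr subr0 innerZl.
  rewrite pmulr_rge0//; have := inner_ge0 (Z n - p).
  rewrite /Q !norm_inner !innerE (innerC x0 (Z n)) (innerC x0 p) (innerC p (Z n)).
  by lra.
have ZQ n : `|x0 - Z n| <= Q.
  by rewrite distrC -(@ler_pXn2r _ 2) ?nnegrE ?normr_ge0 ?ZQ2.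
pose r n := `|Z n - x0| ^+ 2.
(* As [h] decreases, monotonicity of I - T gives <Z n - x0, Z n - Z m> <= 0, equivalent to this
   bound. So [r] increases and, being bounded, makes [Z] Cauchy. *)
have Zr n m : (n <= m)%N -> `|Z n - Z m| ^+ 2 <= r m - r n.
  rewrite leq_eqVlt => /orP[/eqP ->|nm].
    by rewrite !subrr normr0 expr0n /= lexx.
  have hmn : h m < h n by rewrite /h /harmonic/= ltf_pV2 ?posrE ?ltr0n// ltr_nat.
  have := displacement_monotone (Z n) (Z m); rewrite !ZE /r -/(h n) -/(h m).
  have -> : Z n - Z m = (Z n - x0) - (Z m - x0) by rewrite opprB addrA subrK.
  rewrite -(opprB (Z n)) -(opprB (Z m)).
  move: (Z n - x0) (Z m - x0) => a b; rewrite !norm_inner.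
  have ab0 := inner_ge0 (a - b); move: (ab0).
  rewrite !innerE (innerC b a) => ab1 mono.
  move: (h_gt0 n) (h_gt0 m) => hn hm.
  have hs : 0 < h n - h m by lra.
  have := mulr_ge0 (ltW hm) ab1 => hab.
  by rewrite -(ler_pM2l hs); lra.
have rnd : nondecreasing_seq r.
  by move=> n m nm; rewrite -subr_ge0; exact: le_trans (sqr_ge0 _) (Zr _ _ nm).
have rub : has_ubound (range r) by exists (Q ^+ 2) => _ [n _ <-]; exact: ZQ2.
have Zc : cvgn Z.
  apply: (@cvgn_sq_dist _ _ Z (fun n => sup (range r) - r n)).
    rewrite -(subrr (sup (range r))); apply: cvgB; first exact: cvg_cst.
    exact: nondecreasing_cvgn.
  move=> n m /Zr/le_trans; apply; rewrite lerD2r.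
  by apply: ub_le_sup => //; exists m.
pose z := limn Z.
have dZ : `|z - Z n| @[n --> \oo] --> (0 : R).
  rewrite -(normr0 H) -(subrr z); apply: cvg_norm.
  by apply: cvgB; [exact: cvg_cst|].
have Tz : T z = z.
  apply/esym/subr0_eq/eqP; rewrite -normr_le0; apply/eqP.
  have bnd n : `|z - T z| <= 2 * `|z - Z n| + h n * Q.
    have -> : z - T z = (z - Z n) + (Z n - T (Z n)) + (T (Z n) - T z).
      by rewrite !subrKA.
    apply: le_trans (ler_normD _ _) _; have := ler_normD (z - Z n) (Z n - T (Z n)).
    rewrite ZE normrZ gtr0_norm// => h1.
    have := ler_wpM2l (ltW (h_gt0 n)) (ZQ n); have := Tnexp (Z n) z.
    by rewrite (distrC (Z n)) /h; lra.
  apply/eqP; apply: (@ler_cvg_to nat \oo _ R (fun=> `|z - T z|)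
     (fun n => 2 * `|z - Z n| + h n * Q)); first exact: cvg_cst.
    rewrite -[X in _ --> X]addr0; apply: cvgD.
      by rewrite -[X in _ --> X](mulr0 2); apply: cvgM; [exact: cvg_cst|].
    rewrite -[X in _ --> X](mul0r Q); apply: cvgM; [exact: cvg_harmonic|exact: cvg_cst].
  exact: nearW.
exists z => // M e M0 e0.
have Q0 : 0 <= Q by exact: normr_ge0.
(* Replacing [z] by [Z n] in the inner product costs at most (M + Q) |z - Z n|, to be kept below e /
   2. *)
pose D := M + Q + 1; have D0 : 0 < D by rewrite /D; lra.
have [n [nz1 nz2]] : exists n, `|z - Z n| <= 1 /\ `|z - Z n| * D <= e / 2.
  have mu0 : 0 < Num.min 1 (e / 2 / D) by rewrite lt_min ltr01 !divr_gt0.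
  move/cvgr0Pnorm_lt : dZ => /(_ _ mu0)[n _ /(_ n (leqnn n))] /=.
  rewrite normr_id lt_min => /andP[/ltW h1 /ltW h2]; exists n; split=> //.
  by rewrite -ler_pdivlMr.
(* With [n] fixed, monotonicity between [Z n] and [x] bounds h n <x0 - Z n, x - Z n> by |x - T x| |Z
   n - x|, where |Z n - x| <= M + 1. *)
exists (e / 2 * h n / (M + 1)) => [|x xM xT].
  by rewrite !divr_gt0 ?mulr_gt0 ?divr_gt0//; lra.
have xZ : `|Z n - x| <= M + 1.
  have -> : Z n - x = - ((x - z) + (z - Z n)) by rewrite addrA subrK opprB.
  by rewrite normrN; apply: le_trans (ler_normD _ _) _; lra.
have main : '[< x0 - Z n, x - Z n >] <= e / 2.
  rewrite -(ler_pM2l (h_gt0 n)).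
  have := displacement_monotone (Z n) x; rewrite ZE -/(h n).
  rewrite innerDl innerZl innerNl => mono.
  have : `|x - T x| * `|Z n - x| <= e / 2 * h n.
    have M10 : 0 < M + 1 by lra.
    move: xT; rewrite ler_pdivlMr//; apply: le_trans.
    by rewrite ler_wpM2l.
  have := cauchy_schwarz (- (x - T x)) (Z n - x); rewrite normrN innerNl.
  rewrite -(opprB (Z n) x) (innerNr (x0 - Z n)); move: mono; lra.
have -> : '[< x0 - z, x - z >] =
    '[< x0 - Z n, x - Z n >] + '[< Z n - z, x - z >] + '[< x0 - Z n, Z n - z >].
  by rewrite !innerE; ring.
have := cauchy_schwarz (Z n - z) (x - z).
have := cauchy_schwarz (x0 - Z n) (Z n - z).
rewrite (distrC (Z n)) => h1 h2.
have d0 := normr_ge0 (z - Z n).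
have := ler_wpM2r d0 (ZQ n); have := ler_wpM2l d0 xM.
by move: nz2; rewrite /D; lra.
Qed.

(* Each step either has a small displacement, and then [browder_limit] bounds
   the inner product, or a large one, and then the gain
   [c * `|x k - T (x k)| ^+ 2] outweighs the error of order [alpha k];
   both cases give the same recursion for [`|x k - z| ^+ 2]. *)
Theorem halpern_strong_convergence (c : R) (alpha : nat -> R) (x : nat -> H) :
  (exists p, T p = p) -> 0 < c ->
  (forall y z, T z = z ->
    `|T y - z| ^+ 2 <= `|y - z| ^+ 2 - c * `|y - T y| ^+ 2) ->
  (forall k, 0 <= alpha k <= 1) -> alpha k @[k --> \oo] --> (0 : R) ->
  (\sum_(0 <= k <oo) (alpha k)%:E = +oo)%E ->
  (forall k, x k.+1 = alpha k *: x 0%N + (1 - alpha k) *: T (x k)) ->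
  exists2 z, T z = z & x k @[k --> \oo] --> z.
Proof.
move=> [p Tp] c0 Tc a01 a0 aoo xS.
have [z Tz var] := browder_limit (x 0%N) Tp; exists z => //.
pose u := x 0%N - z; pose v k := T (x k) - z; pose D := `|u| ^+ 2.
have xSz k : x k.+1 - z = alpha k *: u + (1 - alpha k) *: v k.
  rewrite xS /u /v !scalerBr addrACA -opprD -scalerDl.
  by rewrite [alpha k + _]addrC subrK scale1r.
have vle k : `|v k| ^+ 2 <= `|x k - z| ^+ 2 - c * `|x k - T (x k)| ^+ 2.
  exact: Tc.
have conv k : `|x k.+1 - z| ^+ 2 <= alpha k * D + (1 - alpha k) * `|v k| ^+ 2.
  have /andP[ak0 ak1] := a01 k; have := inner_ge0 (u - v k).
  rewrite xSz /D; move: (u) (v k) => a b.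
  rewrite !norm_inner !innerE (innerC b a) => h.
  have ak2 : 0 <= alpha k * (1 - alpha k) by rewrite mulr_ge0// subr_ge0.
  by have := mulr_ge0 ak2 h; lra.
have bnd k : `|x k - z| ^+ 2 <= D.
  elim: k => [|k IH]; first by [].
  have /andP[ak0 ak1] := a01 k; have ak1' : 0 <= 1 - alpha k by lra.
  have vD : `|v k| ^+ 2 <= D.
    by have := vle k; have := mulr_ge0 (ltW c0) (sqr_ge0 `|x k - T (x k)|); lra.
  by have := conv k; have := ler_wpM2l ak1' vD; lra.
have s_small e : 0 < e -> \forall k \near \oo, `|x k - z| ^+ 2 <= 2 * (2 * e).
  move=> e0; have e40 : 0 < e / 4 by lra.
  have [eta1 eta10 varx] := var `|u| (e / 4) (normr_ge0 _) e40.
  have u10 : 0 < `|u| + 1 by rewrite ltr_wpDl.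
  (* Since v k = (x k - z) - (x k - T (x k)), each entry of the minimum contributes at most e / 4 to
     <u, v k>. *)
  pose eta := Num.min eta1 (e / 4 / (`|u| + 1)).
  have eta0 : 0 < eta by rewrite lt_min eta10 divr_gt0.
  have D10 : 0 < D + 1 by rewrite ltr_wpDl// sqr_ge0.
  (* For alpha k < mu: 1 - alpha k >= 1/2, alpha k D <= e / 2, and alpha k D <= c eta^2 / 2. The
     first and third settle large displacements, the second small ones. *)
  pose mu := Num.min (1 / 2) (Num.min (e / 2 / (D + 1)) (c * eta ^+ 2 / 2 / (D + 1))).
  have mu0 : 0 < mu by rewrite !lt_min !divr_gt0//= mulr_gt0// exprn_gt0.
  move/cvgr0Pnorm_lt : a0 => /(_ _ mu0)[K _ aK].
  apply: (@eventually_le_of_divergent_weights alpha _ (2 * e) K) => //.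
  - by rewrite mulr_gt0.
  move=> k /aK /=; have /andP[ak0 ak1] := a01 k; rewrite ger0_norm//.
  rewrite !lt_min => /andP[/ltW am1 /andP[/ltW am2 /ltW am3]].
  rewrite !ler_pdivlMr// in am2 am3; have D0 : 0 <= D by rewrite sqr_ge0.
  have ak1' : 0 <= 1 - alpha k by lra.
  have [small|large] := leP `|x k - T (x k)| eta; last first.
    have large2 : eta ^+ 2 <= `|x k - T (x k)| ^+ 2.
      by rewrite ler_pXn2r ?nnegrE ?ltW// (lt_trans eta0).
    have ceta0 : 0 < c * eta ^+ 2 by rewrite mulr_gt0// exprn_gt0.
    have := ler_wpM2l (ltW c0) large2 => cl.
    have /(ler_wpM2l ak1') : `|v k| ^+ 2 <= `|x k - z| ^+ 2 - c * eta ^+ 2.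
      by have := vle k; lra.
    have := conv k; have := mulr_ge0 ak0 (ltW e0).
    have : (1 / 2) * (c * eta ^+ 2) <= (1 - alpha k) * (c * eta ^+ 2).
      by rewrite ler_pM2r//; lra.
    by lra.
  move: small; rewrite le_min => /andP[small1 small2].
  have xu : `|x k - z| <= `|u| by rewrite -(@ler_pXn2r _ 2) ?nnegrE.
  have uv : '[< u, v k >] <= e / 2.
    have -> : v k = (x k - z) - (x k - T (x k)).
      by rewrite opprB addrC subrKA.
    have := varx _ xu small1; rewrite -/u => h1; rewrite innerDr innerNr.
    have := cauchy_schwarz (- u) (x k - T (x k)); rewrite normrN innerNl => h2.
    move: small2; rewrite ler_pdivlMr// => h3.
    by have := normr_ge0 (x k - T (x k)); lra.
  have vs : `|v k| ^+ 2 <= `|x k - z| ^+ 2.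
    by have := vle k; have := mulr_ge0 (ltW c0) (sqr_ge0 `|x k - T (x k)|); lra.
  (* From |a + b|^2 <= |b|^2 + 2 <a, a + b> with a = alpha k u and b = (1 - alpha k) v k, and (1 -
     alpha k)^2 <= 1 - alpha k. *)
  have key : `|x k.+1 - z| ^+ 2 <=
      (1 - alpha k) * `|v k| ^+ 2 + 2 * alpha k * (alpha k * D + (1 - alpha k) * '[< u, v k >]).
    rewrite xSz /D; move: (u) (v k) => a b.
    have := mulr_ge0 (mulr_ge0 ak0 ak0) (inner_ge0 a).
    have := mulr_ge0 (mulr_ge0 ak0 ak1') (inner_ge0 b).
    by rewrite !norm_inner !innerE (innerC b a); lra.
  have uy : alpha k * D + (1 - alpha k) * '[< u, v k >] <= e.
    have := ler_wpM2l ak1' uv; have := mulr_ge0 ak0 (ltW e0); lra.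
  have := ler_wpM2l ak0 uy; have := ler_wpM2l ak1' vs; lra.
apply/cvgrPdist_le => e e0; have e20 : 0 < e ^+ 2 / 4 by rewrite divr_gt0// exprn_gt0.
apply: filterS (s_small _ e20) => k sk.
rewrite distrC -(@ler_pXn2r _ 2) ?nnegrE ?(ltW e0)//.
by apply: le_trans sk _; lra.
Qed.

End Halpern.

(** * The split operator *)

Section SplitOperator.
Variables (R : realType) (H1 H2 : hilbertType R).
Variables (B1 : H1 -> set H1) (F1 : H2 -> set H2) (A : {linear H1 -> H2}).
Variables (lambda gamma : R).
Hypotheses (B1max : maximal_monotone B1) (F1max : maximal_monotone F1).
Hypotheses (Abnd : bounded_fun_norm A) (l0 : 0 < lambda) (g0 : 0 < gamma).
Local Notation L := (opnorm (adjoint A \o A)).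
Hypothesis gL : gamma * L < 2.

Local Notation J1 := (resolvent lambda B1).
Local Notation J2 := (resolvent lambda F1).
Local Notation U := (forward_step F1 A lambda gamma).
Local Notation d x := (A x - J2 (A x)).
Local Notation T x := (J1 (U x)).

Let c0 := gamma * (2 - gamma * L).

Let c0_gt0 : 0 < c0. Proof. by rewrite mulr_gt0// subr_gt0. Qed.

(** I - J2 is firmly nonexpansive, so the cross term gives - 2 gamma |d x - d y|^2, while the
    quadratic term is at most gamma^2 L |d x - d y|^2. Their sum is the [c0] term. *)
Lemma forward_step_descent x y :
  `|U x - U y| ^+ 2 <= `|x - y| ^+ 2 - c0 * `|d x - d y| ^+ 2.
Proof.
have -> : U x - U y = (x - y) - gamma *: adjoint A (d x - d y).
  rewrite /forward_step (adjointB Abnd (d x)) scalerBr.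
  by rewrite !opprD !opprK addrACA.
have := sq_norm_adjoint_le_opnorm Abnd (d x - d y).
move=> /(ler_wpM2l (sqr_ge0 gamma)) hA.
have firm : `|d x - d y| ^+ 2 <= '[< x - y, adjoint A (d x - d y) >].
  rewrite -(adjointP Abnd) (linearB A).
  have := resolvent_firmly_nonexpansive F1max l0 (A x) (A y).
  rewrite !norm_inner.
  have -> : d x - d y = (A x - A y) - (J2 (A x) - J2 (A y)).
    by rewrite !opprD !opprK addrACA.
  move: (A x - A y) (J2 (A x) - J2 (A y)) => a j.
  by rewrite !innerE (innerC j a); lra.
move: firm => /(ler_wpM2l (ltW g0)).
move: hA; move: (d x - d y) (x - y) => e v; rewrite /c0 !norm_inner.
move: (adjoint A e) => a; rewrite !innerE (innerC a v).
by move: '[< e, e >] '[< a, a >] '[< v, a >] '[< v, v >] => *; nra.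
Qed.

Lemma split_descent x y : `|T x - T y| ^+ 2 <=
  `|x - y| ^+ 2 - c0 * `|d x - d y| ^+ 2 - `|(U x - T x) - (U y - T y)| ^+ 2.
Proof.
have := forward_step_descent x y.
have := resolvent_firmly_nonexpansive B1max l0 (U x) (U y).
have -> : (U x - T x) - (U y - T y) = (U x - U y) - (T x - T y).
  by rewrite !opprD !opprK addrACA.
move: (U x - U y) (T x - T y) => a j; rewrite !norm_inner.
by rewrite !innerE (innerC j a); lra.
Qed.

Lemma split_nonexpansive x y : `|T x - T y| <= `|x - y|.
Proof.
rewrite -(@ler_pXn2r _ 2) ?nnegrE//.
have := split_descent x y; have := sqr_ge0 `|(U x - T x) - (U y - T y)|.
by have := mulr_ge0 (ltW c0_gt0) (sqr_ge0 `|d x - d y|); lra.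
Qed.

Lemma solution_displacement w : solution_set B1 F1 A w ->
  [/\ d w = 0, U w = w & T w = w].
Proof.
move=> [Bw Fw].
have dw : d w = 0 by rewrite (resolvent_fixedP F1max l0 _).2// subrr.
have Uw : U w = w.
  rewrite /forward_step [X in adjoint A X]dw -(subrr 0) (adjointB Abnd).
  by rewrite subrr scaler0 subr0.
by split=> //; rewrite Uw; apply/resolvent_fixedP.
Qed.

(** Comparison with a known solution [w]: as [x] and [w] are both fixed, the two losses in
    [split_descent] vanish, giving J2 (A x) = A x and U x = x. *)
Lemma split_fixed x : solution_set B1 F1 A !=set0 -> T x = x ->
  solution_set B1 F1 A x.
Proof.
move=> [w Gw] Tx; have [dw Uw Tw] := solution_displacement Gw.
have := split_descent x w; rewrite Tx Tw.
rewrite [X in c0 * X](_ : _ = `|d x| ^+ 2) ?dw ?subr0//.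
rewrite Uw subrr subr0 => h.
have dx2 : 0 <= c0 * `|d x| ^+ 2 by rewrite mulr_ge0 ?sqr_ge0// ltW.
have Ux2 := sqr_ge0 `|U x - x|.
have dx : d x = 0.
  have /eqP : c0 * `|d x| ^+ 2 = 0 by lra.
  by rewrite mulf_eq0 gt_eqF//= sqrf_eq0 normr_eq0 => /eqP.
have Ux : U x = x.
  by apply/eqP; rewrite -subr_eq0 -normr_eq0 -sqrf_eq0; apply/eqP; lra.
split; last by apply/(resolvent_fixedP F1max l0)/esym/subr0_eq.
by apply/(resolvent_fixedP B1max l0); rewrite -{1}Ux.
Qed.

Lemma split_strongly_quasinonexpansive : exists2 c, 0 < c &
  forall x w, solution_set B1 F1 A w ->
    `|T x - w| ^+ 2 <= `|x - w| ^+ 2 - c * `|x - T x| ^+ 2.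
Proof.
have L0 := opnorm_adjoint_ge0 Abnd.
(* |x - T x|^2 <= 2 |x - U x|^2 + 2 |U x - T x|^2 and |x - U x|^2 <= gamma^2 L |d x|^2; [M] absorbs
   both coefficients into the losses of [split_descent]. *)
pose M := 2 * gamma ^+ 2 * L / c0 + 2.
have M2 : 2 <= M.
  rewrite lerDr; apply: divr_ge0; last exact: ltW.
  by rewrite mulr_ge0// mulr_ge0// sqr_ge0.
have M0 : 0 < M by lra.
exists M^-1; first by rewrite invr_gt0.
move=> x w Gw.
have [dw Uw Tw] := solution_displacement Gw.
have := split_descent x w; rewrite Tw.
rewrite [X in c0 * X](_ : _ = `|d x| ^+ 2) ?dw ?subr0//.
rewrite Uw subrr subr0 => h; apply: le_trans h _.
rewrite -addrA lerD2l -opprD lerN2 mulrC ler_pdivrMr//.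
have xU : `|x - U x| ^+ 2 <= gamma ^+ 2 * (L * `|d x| ^+ 2).
  rewrite /forward_step opprB addrC subrK normrZ exprMn (gtr0_norm g0).
  by rewrite ler_wpM2l ?sqr_ge0// sq_norm_adjoint_le_opnorm.
have -> : x - T x = (x - U x) + (U x - T x) by rewrite addrA subrK.
have -> : (c0 * `|d x| ^+ 2 + `|U x - T x| ^+ 2) * M =
    2 * gamma ^+ 2 * L * `|d x| ^+ 2 + 2 * c0 * `|d x| ^+ 2 + M * `|U x - T x| ^+ 2.
  by rewrite /M; field; rewrite gt_eqF.
have := ler_wpM2r (sqr_ge0 `|U x - T x|) M2.
have := mulr_ge0 (ltW c0_gt0) (sqr_ge0 `|d x|).
move: xU; move: (x - U x) (U x - T x) (d x) => a b e.
have := inner_ge0 (a - b); rewrite !norm_inner !innerE (innerC b a).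
by lra.
Qed.

End SplitOperator.

(* In \bar R one has 2 / 0 = +oo, so A = 0 (L = 0) is covered. *)
Theorem theorem4p5 (R : realType) (H1 H2 : hilbertType R)
    (B1 : H1 -> set H1) (F1 : H2 -> set H2) (A : {linear H1 -> H2})
    (lambda gamma : R) (alpha : nat -> R) (x0 : H1) (x : nat -> H1)
    (hB1 : maximal_monotone B1) (hF1 : maximal_monotone F1)
    (hA : bounded_fun_norm A)
    (hlambda : 0 < lambda)
    (hGamma : solution_set B1 F1 A !=set0)
    (hgamma0 : 0 < gamma)
    (hgammaL : (gamma%:E < 2%:E / (opnorm (adjoint A \o A))%:E)%E)
    (halpha01 : forall k, 0 <= alpha k <= 1)
    (halpha0 : alpha k @[k --> \oo] --> (0 : R))
    (halphaoo : (\sum_(0 <= k <oo) (alpha k)%:E = +oo)%E)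
    (hx0 : x 0%N = x0)
    (hxS : forall k, x k.+1 = alpha k *: x0 +
      (1 - alpha k) *: resolvent lambda B1 (forward_step F1 A lambda gamma (x k))) :
  exists2 xstar : H1, solution_set B1 F1 A xstar &
    x k @[k --> \oo] --> xstar.
Proof.
have gL : gamma * opnorm (adjoint A \o A) < 2.
  have [->|L0] := eqVneq (opnorm (adjoint A \o A)) 0; first by rewrite mulr0.
  have Lgt0 : 0 < opnorm (adjoint A \o A).
    by rewrite lt_def L0 opnorm_adjoint_ge0.
  by move: hgammaL; rewrite inver (negbTE L0) -EFinM lte_fin ltr_pdivlMr.
pose T y := resolvent lambda B1 (forward_step F1 A lambda gamma y).
(* Translates between the fixed points in Halpern's theorem and the solutions of the inclusion. *)
have fixedP z : T z = z <-> solution_set B1 F1 A z.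
  split; first exact: split_fixed.
  by move=> Gz; have [] := solution_displacement gamma hB1 hF1 hA hlambda Gz.
have [c c0 Tc] :=
  split_strongly_quasinonexpansive hB1 hF1 hA hlambda hgamma0 gL.
have [||||||||z /fixedP Gz xz] := @halpern_strong_convergence R H1 T _ c alpha x.
- exact: split_nonexpansive.
- by have [p /fixedP Tp] := hGamma; exists p.
- exact: c0.
- by move=> y z /fixedP; exact: Tc.
- exact: halpha01.
- exact: halpha0.
- exact: halphaoo.
- by move=> k; rewrite hxS hx0.
by exists z.
Qed.
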